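(* Let $\mathcal C$ be a category and $J\colon \mathcal{C}\to 2\mathrm{Vect}_{\mathbb K}$ a functor. The Stolz--Teichner category $\mathcal{C}^J_{\mathrm{ST}}$ is naturally equivalent to the full subcategory of $\mathcal{C}^J$ on the objects $(X_i,J(X_i))$, where $X_i$ ranges over the objects of $\mathcal C$ and $J(X_i)$ is seen as a right $J(X_i)$-module.
   Context: $\mathbb{K}$ is a field. $2\mathrm{Vect}_{\mathbb K}$ is the Morita 2-category: objects are finite-dimensional $\mathbb K$-algebras, a 1-morphism $A_0\to A_1$ is an $(A_1,A_0)$-bimodule finite-dimensional over $\mathbb K$, 2-morphisms are bimodule maps, the composite of $M_{10}\colon A_0\to A_1$ and $M_{21}\colon A_1\to A_2$ is $M_{21}\otimes_{A_1}M_{10}$, and the identity of $A$ is the bimodule $A$. ''Category'' means higher category (identified with its nerve) and ''functor'' means functor of higher categories; since all targets are 2-categories, $\mathcal C$ may be taken to be a 2-category. A 2-simplex $\Xi_{ijk}$ of $\mathcal C$ consists of 1-morphisms $f_{ij}\colon X_i\to X_j$, $f_{jk}\colon X_j\to X_k$, $f_{ik}\colon X_i\to X_k$ and a 2-cell $\Xi_{ijk}\colon f_{jk}\circ f_{ij}\Rightarrow f_{ik}$. A functor $J\colon\mathcal C\to 2\mathrm{Vect}_{\mathbb K}$ assigns to $X$ an algebra $J(X)$, to $f_{ij}$ a $(J(X_j),J(X_i))$-bimodule $J(f_{ij})$, with $J(\mathrm{id}_X)=J(X)$, and to each 2-simplex a bimodule map $J(\Xi_{ijk})\colon J(f_{jk})\otimes_{J(X_j)}J(f_{ij})\to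 J(f_{ik})$, satisfying the usual coherence on 3-simplices and units. The extension $\mathcal C^J$ is the lax homotopy pullback of $J\colon \mathcal C\to 2\mathrm{Vect}_{\mathbb K}$ and the inclusion $*\to 2\mathrm{Vect}_{\mathbb K}$ of the object $\mathbb K$. Explicitly: objects are pairs $(X_i,L_{X_i})$ with $L_{X_i}$ a (finite-dimensional) right $J(X_i)$-module; morphisms $(X_i,L_{X_i})\to(X_j,L_{X_j})$ are pairs $(f_{ij},\varphi_{f_{ij}})$ with $f_{ij}\colon X_i\to X_j$ and $\varphi_{f_{ij}}\colon L_{X_i}\to L_{X_j}\otimes_{J(X_j)}J(f_{ij})$ a map of right $J(X_i)$-modules; 2-simplices are 2-simplices $\Xi_{ijk}$ of $\mathcal C$ with edges decorated so that $\varphi_{f_{ik}}=(\mathrm{id}\otimes J(\Xi_{ijk}))\circ(\varphi_{f_{jk}}\otimes\mathrm{id})\circ\varphi_{f_{ij}}$; for $k\ge3$ a $k$-simplex is a $k$-simplex of $\mathcal C$ with a lift of its boundary. The Stolz--Teichner category $\mathcal C^J_{\mathrm{ST}}$: objects are those of $\mathcal C$; morphisms $X_i\to X_j$ are pairs $(f_{ij},v_{f_{ij}})$ with $f_{ij}\colon X_i\to X_j$ in $\mathcal C$ and $v_{f_{ij}}\in J(f_{ij})$; 2-simplices are 2-simplices $\Xi_{ijk}$ of $\mathcal C$ with edges decorated so that $J(\Xi_{ijk})(v_{f_{jk}}\otimes v_{f_{ij}})=v_{f_{ik}}$; for $k\ge 3$ the set of $k$-simplices is the fiber product $\Delta^k(\mathcal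 C^J_{\mathrm{ST}})=\Delta^k(\mathcal C)\times_{\partial\Delta^k(\mathcal C)}\partial\Delta^k(\mathcal C^J_{\mathrm{ST}})$. *)

(* Defs.v *)
From HB Require Import structures.
From mathcomp Require Import all_boot all_order all_algebra.
From mathcomp Require Import boolp.

Set Implicit Arguments.
Unset Strict Implicit.
Unset Printing Implicit Defensive.

Import GRing.Theory.
Local Open Scope ring_scope.

(* [comp1 g f] and [vcomp b a] are in applicative order: [f], resp. [a],
   comes first.  [hcomp b a] is the horizontal composite of [b : g => g'] with
   [a : f => f'], a 2-cell from [comp1 g f] to [comp1 g' f']. *)
Record bicategory := Bicategory {
  ob :> Type;
  hom1 : ob -> ob -> Type;
  cell : forall x y, hom1 x y -> hom1 x y -> Type;
  id1 : forall x, hom1 x x;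
  comp1 : forall x y z, hom1 y z -> hom1 x y -> hom1 x z;
  id2 : forall x y (f : hom1 x y), cell f f;
  vcomp : forall x y (f g h : hom1 x y), cell g h -> cell f g -> cell f h;
  hcomp : forall x y z (g g' : hom1 y z) (f f' : hom1 x y),
    cell g g' -> cell f f' -> cell (comp1 g f) (comp1 g' f');
  assoc : forall x y z w (h : hom1 z w) (g : hom1 y z) (f : hom1 x y),
    cell (comp1 (comp1 h g) f) (comp1 h (comp1 g f));
  assocV : forall x y z w (h : hom1 z w) (g : hom1 y z) (f : hom1 x y),
    cell (comp1 h (comp1 g f)) (comp1 (comp1 h g) f);
  lunit : forall x y (f : hom1 x y), cell (comp1 (id1 y) f) f;
  lunitV : forall x y (f : hom1 x y), cell f (comp1 (id1 y) f);
  runit : forall x y (f : hom1 x y), cell (comp1 f (id1 x)) f;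
  runitV : forall x y (f : hom1 x y), cell f (comp1 f (id1 x));
  vcompA : forall x y (f g h k : hom1 x y)
    (c : cell h k) (b : cell g h) (a : cell f g),
    vcomp c (vcomp b a) = vcomp (vcomp c b) a;
  vcomp1l : forall x y (f g : hom1 x y) (a : cell f g), vcomp (id2 g) a = a;
  vcomp1r : forall x y (f g : hom1 x y) (a : cell f g), vcomp a (id2 f) = a;
  hcomp_id : forall x y z (g : hom1 y z) (f : hom1 x y),
    hcomp (id2 g) (id2 f) = id2 (comp1 g f);
  hcomp_vcomp : forall x y z (g g' g'' : hom1 y z) (f f' f'' : hom1 x y)
    (b' : cell g' g'') (b : cell g g') (a' : cell f' f'') (a : cell f f'),
    hcomp (vcomp b' b) (vcomp a' a) = vcomp (hcomp b' a') (hcomp b a);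
  assoc_nat : forall x y z w (h h' : hom1 z w) (g g' : hom1 y z)
    (f f' : hom1 x y) (c : cell h h') (b : cell g g') (a : cell f f'),
    vcomp (assoc h' g' f') (hcomp (hcomp c b) a)
    = vcomp (hcomp c (hcomp b a)) (assoc h g f);
  lunit_nat : forall x y (f f' : hom1 x y) (a : cell f f'),
    vcomp (lunit f') (hcomp (id2 (id1 y)) a) = vcomp a (lunit f);
  runit_nat : forall x y (f f' : hom1 x y) (a : cell f f'),
    vcomp (runit f') (hcomp a (id2 (id1 x))) = vcomp a (runit f);
  assocK : forall x y z w (h : hom1 z w) (g : hom1 y z) (f : hom1 x y),
    vcomp (assocV h g f) (assoc h g f) = id2 _;
  assocVK : forall x y z w (h : hom1 z w) (g : hom1 y z) (f : hom1 x y),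
    vcomp (assoc h g f) (assocV h g f) = id2 _;
  lunitK : forall x y (f : hom1 x y), vcomp (lunitV f) (lunit f) = id2 _;
  lunitVK : forall x y (f : hom1 x y), vcomp (lunit f) (lunitV f) = id2 _;
  runitK : forall x y (f : hom1 x y), vcomp (runitV f) (runit f) = id2 _;
  runitVK : forall x y (f : hom1 x y), vcomp (runit f) (runitV f) = id2 _;
  pentagon : forall x y z w u
    (k : hom1 w u) (h : hom1 z w) (g : hom1 y z) (f : hom1 x y),
    vcomp (hcomp (id2 k) (assoc h g f))
      (vcomp (assoc k (comp1 h g) f) (hcomp (assoc k h g) (id2 f)))
    = vcomp (assoc k h (comp1 g f)) (assoc (comp1 k h) g f);
  triangle : forall x y z (g : hom1 y z) (f : hom1 x y),
    vcomp (hcomp (id2 g) (lunit f)) (assoc g (id1 y) f)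
    = hcomp (runit g) (id2 f)
}.

Arguments hom1 {_}.
Arguments cell {_ x y}.
Arguments id1 {_}.
Arguments comp1 {_ x y z}.
Arguments id2 {_ x y}.
Arguments vcomp {_ x y f g h}.
Arguments hcomp {_ x y z g g' f f'}.
Arguments assoc {_ x y z w}.
Arguments assocV {_ x y z w}.
Arguments lunit {_ x y}.
Arguments lunitV {_ x y}.
Arguments runit {_ x y}.
Arguments runitV {_ x y}.

Notation "g \o1 f" := (comp1 g f) (at level 40, left associativity).
Notation "b \ov a" := (vcomp b a) (at level 48, left associativity).
Notation "b \oh a" := (hcomp b a) (at level 44, left associativity).

Definition invertible2 (B : bicategory) (x y : B) (f g : hom1 x y)
    (a : cell f g) : Prop :=
  exists b : cell g f, b \ov a = id2 f /\ a \ov b = id2 g.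

Definition iso1 (B : bicategory) (x y : B) (f g : hom1 x y) : Prop :=
  exists a : cell f g, invertible2 a.

Definition equivalent_obs (B : bicategory) (x y : B) : Prop :=
  exists (f : hom1 x y) (g : hom1 y x),
    iso1 (g \o1 f) (id1 x) /\ iso1 (f \o1 g) (id1 y).

(* A 1-morphism bundled with its source and target, so that 1-morphisms with
   propositionally equal end points can be compared. *)
Definition arrow (B : bicategory) (x y : B) (f : hom1 x y) :
    {xy : B * B & hom1 xy.1 xy.2} :=
  existT (fun xy : B * B => hom1 xy.1 xy.2) (x, y) f.

Record lax_functor (B C : bicategory) := LaxFunctor {
  F0 :> B -> C;
  F1 : forall x y, hom1 x y -> hom1 (F0 x) (F0 y);
  F2 : forall x y (f g : hom1 x y), cell f g -> cell (F1 f) (F1 g);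
  lax_id : forall x, cell (id1 (F0 x)) (F1 (id1 x));
  lax_comp : forall x y z (g : hom1 y z) (f : hom1 x y),
    cell (F1 g \o1 F1 f) (F1 (g \o1 f));
  F2_id : forall x y (f : hom1 x y), F2 (id2 f) = id2 (F1 f);
  F2_vcomp : forall x y (f g h : hom1 x y) (b : cell g h) (a : cell f g),
    F2 (b \ov a) = F2 b \ov F2 a;
  lax_comp_nat : forall x y z (g g' : hom1 y z) (f f' : hom1 x y)
    (b : cell g g') (a : cell f f'),
    F2 (b \oh a) \ov lax_comp g f = lax_comp g' f' \ov (F2 b \oh F2 a);
  lax_assoc : forall x y z w (h : hom1 z w) (g : hom1 y z) (f : hom1 x y),
    F2 (assoc h g f) \ov (lax_comp (h \o1 g) f
      \ov (lax_comp h g \oh id2 (F1 f)))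
    = lax_comp h (g \o1 f) \ov ((id2 (F1 h) \oh lax_comp g f)
      \ov assoc (F1 h) (F1 g) (F1 f));
  lax_lunit : forall x y (f : hom1 x y),
    F2 (lunit f) \ov (lax_comp (id1 y) f \ov (lax_id y \oh id2 (F1 f)))
    = lunit (F1 f);
  lax_runit : forall x y (f : hom1 x y),
    F2 (runit f) \ov (lax_comp f (id1 x) \ov (id2 (F1 f) \oh lax_id x))
    = runit (F1 f)
}.

Arguments F1 {B C} _ {x y}.
Arguments F2 {B C} _ {x y f g}.
Arguments lax_id {B C}.
Arguments lax_comp {B C} _ {x y z}.

(* Maps between nerves of bicategories (with possibly non-invertible 2-cells
   as 2-simplices) are lax functors that preserve identity 1-morphisms;
   preservation is up to an invertible 2-cell here.  Pseudofunctors are the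
   special case in which the comparison 2-cells [lax_comp] are invertible. *)
Record normal_lax_functor (B C : bicategory) := NormalLaxFunctor {
  nlf_lax :> lax_functor B C;
  nlf_normal : forall x, invertible2 (lax_id nlf_lax x)
}.

Record pseudofunctor (B C : bicategory) := Pseudofunctor {
  pf_lax :> lax_functor B C;
  pf_id_inv : forall x, invertible2 (lax_id pf_lax x);
  pf_comp_inv : forall x y z (g : hom1 y z) (f : hom1 x y),
    invertible2 (lax_comp pf_lax g f)
}.

(* The value of a lax functor on the 2-simplex [s : g \o1 f => h]. *)
Definition F_simplex (B C : bicategory) (F : lax_functor B C) (x y z : B)
    (g : hom1 y z) (f : hom1 x y) (h : hom1 x z) (s : cell (g \o1 f) h) :
    cell (F1 F g \o1 F1 F f) (F1 F h) :=
  F2 F s \ov lax_comp F g f.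

(* Essentially surjective on objects, and an equivalence of categories
   (essentially surjective, full and faithful) on all categories of
   1-morphisms. *)
Definition biequivalence (B C : bicategory) (F : pseudofunctor B C) : Prop :=
  [/\ forall c : C, exists b : B, equivalent_obs (F b) c,
      forall (x y : B) (k : hom1 (F x) (F y)),
        exists f : hom1 x y, iso1 (F1 F f) k
    & forall (x y : B) (f g : hom1 x y), bijective (@F2 _ _ F x y f g)].

Section Compose.
Variables (A B C : bicategory).

Section Lax.
Variables (G : lax_functor B C) (F : lax_functor A B).

Definition lfc_id (x : A) : cell (id1 (G (F x))) (F1 G (F1 F (id1 x))) :=
  F2 G (lax_id F x) \ov lax_id G (F x).

Definition lfc_comp (x y z : A) (g : hom1 y z) (f : hom1 x y) :
    cell (F1 G (F1 F g) \o1 F1 G (F1 F f)) (F1 G (F1 F (g \o1 f))) :=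
  F2 G (lax_comp F g f) \ov lax_comp G (F1 F g) (F1 F f).

Lemma hcomp_vcomp_idr (D : bicategory) (x y z : D) (g g' g'' : hom1 y z)
    (f : hom1 x y) (b' : cell g' g'') (b : cell g g') :
  (b' \ov b) \oh id2 f = (b' \oh id2 f) \ov (b \oh id2 f).
Proof. by rewrite -hcomp_vcomp vcomp1l. Qed.

Lemma hcomp_vcomp_idl (D : bicategory) (x y z : D) (g : hom1 y z)
    (f f' f'' : hom1 x y) (a' : cell f' f'') (a : cell f f') :
  id2 g \oh (a' \ov a) = (id2 g \oh a') \ov (id2 g \oh a).
Proof. by rewrite -hcomp_vcomp vcomp1l. Qed.

Definition lf_comp : lax_functor A C.
Proof.
apply: (@LaxFunctor A C (fun x => G (F x)) (fun x y f => F1 G (F1 F f))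
  (fun x y f g a => F2 G (F2 F a)) lfc_id lfc_comp).
- abstract (by move=> x y f; rewrite !F2_id).
- abstract (by move=> x y f g h b a; rewrite !F2_vcomp).
- abstract (move=> x y z g g' f f' b a;
    rewrite /lfc_comp vcompA -F2_vcomp lax_comp_nat;
    by rewrite F2_vcomp -!vcompA lax_comp_nat).
- abstract (move=> x y z w h g f; rewrite /lfc_comp;
    rewrite hcomp_vcomp_idr hcomp_vcomp_idl -!vcompA;
    rewrite [lax_comp G (F1 F (h \o1 g)) _ \ov _]vcompA -[id2 (F1 G _)]F2_id;
    rewrite -lax_comp_nat -!vcompA;
    rewrite [F2 G (lax_comp F _ _) \ov (F2 G _ \ov _)]vcompA -F2_vcomp;
    rewrite vcompA -F2_vcomp lax_assoc !F2_vcomp -!vcompA F2_id lax_assoc;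
    congr (_ \ov _); rewrite !vcompA; congr (_ \ov _); congr (_ \ov _);
    by rewrite lax_comp_nat F2_id).
- abstract (move=> x y f; rewrite /lfc_comp /lfc_id;
    rewrite hcomp_vcomp_idr -!vcompA -[id2 (F1 G _)]F2_id;
    rewrite [lax_comp G _ _ \ov (_ \ov _)]vcompA -lax_comp_nat -!vcompA;
    rewrite [F2 G (lax_comp F _ _) \ov (F2 G _ \ov _)]vcompA -F2_vcomp;
    by rewrite vcompA -F2_vcomp lax_lunit F2_id lax_lunit).
- abstract (move=> x y f; rewrite /lfc_comp /lfc_id;
    rewrite hcomp_vcomp_idl -!vcompA -[id2 (F1 G _)]F2_id;
    rewrite [lax_comp G _ _ \ov (_ \ov _)]vcompA -lax_comp_nat -!vcompA;
    rewrite [F2 G (lax_comp F _ _) \ov (F2 G _ \ov _)]vcompA -F2_vcomp;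
    by rewrite vcompA -F2_vcomp lax_runit F2_id lax_runit).
Defined.

End Lax.

Lemma invertible2_vcomp (D : bicategory) (x y : D) (f g h : hom1 x y)
    (b : cell g h) (a : cell f g) :
  invertible2 b -> invertible2 a -> invertible2 (b \ov a).
Proof.
move=> [b' [bK b'K]] [a' [aK a'K]]; exists (a' \ov b'); split.
  by rewrite -vcompA [b' \ov _]vcompA bK vcomp1l.
by rewrite -vcompA [a \ov _]vcompA a'K vcomp1l.
Qed.

Lemma invertible2_F2 (D E : bicategory) (H : lax_functor D E) (x y : D)
    (f g : hom1 x y) (a : cell f g) : invertible2 a -> invertible2 (F2 H a).
Proof.
by move=> [b [bK aK]]; exists (F2 H b); rewrite -!F2_vcomp bK aK !F2_id.
Qed.

Lemma pf_comp_subproof (G : pseudofunctor B C) (F : pseudofunctor A B) :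
  (forall x, invertible2 (lax_id (lf_comp G F) x)) /\
  (forall x y z (g : hom1 y z) (f : hom1 x y),
     invertible2 (lax_comp (lf_comp G F) g f)).
Proof.
split=> *; apply: invertible2_vcomp.
- exact: (invertible2_F2 (pf_lax G) (pf_id_inv F _)).
- exact: (pf_id_inv G).
- exact: (invertible2_F2 (pf_lax G) (pf_comp_inv F _ _)).
- exact: (pf_comp_inv G).
Qed.

Definition pf_comp (G : pseudofunctor B C) (F : pseudofunctor A B) :
    pseudofunctor A C :=
  Pseudofunctor (proj1 (pf_comp_subproof G F)) (proj2 (pf_comp_subproof G F)).

End Compose.

Section FullSub.
Variables (B : bicategory) (P : B -> Prop).

Definition full_sub : bicategory :=
  @Bicategory {x : B | P x}
    (fun x y => hom1 (sval x) (sval y))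
    (fun x y f g => cell f g)
    (fun x => id1 (sval x))
    (fun x y z g f => g \o1 f)
    (fun x y f => id2 f)
    (fun x y f g h b a => b \ov a)
    (fun x y z g g' f f' b a => b \oh a)
    (fun x y z w => assoc) (fun x y z w => assocV)
    (fun x y => lunit) (fun x y => lunitV)
    (fun x y => runit) (fun x y => runitV)
    (fun x y => @vcompA B _ _) (fun x y => @vcomp1l B _ _)
    (fun x y => @vcomp1r B _ _)
    (fun x y z => @hcomp_id B _ _ _) (fun x y z => @hcomp_vcomp B _ _ _)
    (fun x y z w => @assoc_nat B _ _ _ _)
    (fun x y => @lunit_nat B _ _) (fun x y => @runit_nat B _ _)
    (fun x y z w => @assocK B _ _ _ _) (fun x y z w => @assocVK B _ _ _ _)
    (fun x y => @lunitK B _ _) (fun x y => @lunitVK B _ _)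
    (fun x y => @runitK B _ _) (fun x y => @runitVK B _ _)
    (fun x y z w u => @pentagon B _ _ _ _ _)
    (fun x y z => @triangle B _ _ _).

Lemma id2_invertible (D : bicategory) (x y : D) (f : hom1 x y) :
  invertible2 (id2 f).
Proof. by exists (id2 f); rewrite vcomp1l. Qed.

Definition full_incl_lax : lax_functor full_sub B.
Proof.
apply: (@LaxFunctor full_sub B (fun x => sval x) (fun x y f => f)
  (fun x y f g a => a) (fun x => id2 (id1 (sval x)))
  (fun x y z g f => id2 (@comp1 B _ _ _ g f))).
- abstract (by []).
- abstract (by []).
- abstract (by move=> x y z g g' f f' b a; rewrite vcomp1l vcomp1r).
- abstract (by move=> x y z w h g f; rewrite !hcomp_id !vcomp1l vcomp1r).
- abstract (by move=> x y f; rewrite !hcomp_id !vcomp1r).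
- abstract (by move=> x y f; rewrite !hcomp_id !vcomp1r).
Defined.

Definition full_incl : pseudofunctor full_sub B :=
  @Pseudofunctor full_sub B full_incl_lax
    (fun x => id2_invertible _) (fun x y z g f => id2_invertible _).

End FullSub.

(* The objects and 1-morphisms of the decorated bicategory are objects and
   1-morphisms of [C] with additional data; its 2-cells are the 2-cells of [C]
   that are compatible with these data.  As compatibility is a proposition, a
   simplex of dimension at least 3 of the nerve is a simplex of [C] together
   with a lift of its boundary. *)
Record decoration (C : bicategory) := Decoration {
  dob : Type;
  dbase : dob -> C;
  dhom : forall x y : dob, hom1 (dbase x) (dbase y) -> Type;
  dcell : forall (x y : dob) (f g : hom1 (dbase x) (dbase y)),
    cell f g -> dhom f -> dhom g -> Prop;
  did1 : forall x : dob, dhom (id1 (dbase x));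
  dcomp1 : forall (x y z : dob)
    (g : hom1 (dbase y) (dbase z)) (f : hom1 (dbase x) (dbase y)),
    dhom g -> dhom f -> dhom (g \o1 f);
  did2 : forall (x y : dob) (f : hom1 (dbase x) (dbase y)) (u : dhom f),
    dcell (id2 f) u u;
  dvcomp : forall (x y : dob) (f g h : hom1 (dbase x) (dbase y))
    (b : cell g h) (a : cell f g) (u : dhom f) (v : dhom g) (w : dhom h),
    dcell b v w -> dcell a u v -> dcell (b \ov a) u w;
  dhcomp : forall (x y z : dob) (g g' : hom1 (dbase y) (dbase z))
    (f f' : hom1 (dbase x) (dbase y)) (b : cell g g') (a : cell f f')
    (v : dhom g) (v' : dhom g') (u : dhom f) (u' : dhom f'),
    dcell b v v' -> dcell a u u' ->
    dcell (b \oh a) (dcomp1 v u) (dcomp1 v' u');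
  dassoc : forall (x y z w : dob) (h : hom1 (dbase z) (dbase w))
    (g : hom1 (dbase y) (dbase z)) (f : hom1 (dbase x) (dbase y))
    (t : dhom h) (v : dhom g) (u : dhom f),
    dcell (assoc h g f) (dcomp1 (dcomp1 t v) u) (dcomp1 t (dcomp1 v u));
  dlunit : forall (x y : dob) (f : hom1 (dbase x) (dbase y)) (u : dhom f),
    dcell (lunit f) (dcomp1 (did1 y) u) u;
  drunit : forall (x y : dob) (f : hom1 (dbase x) (dbase y)) (u : dhom f),
    dcell (runit f) (dcomp1 u (did1 x)) u;
  dinv : forall (x y : dob) (f g : hom1 (dbase x) (dbase y))
    (a : cell f g) (b : cell g f) (u : dhom f) (v : dhom g),
    b \ov a = id2 f -> dcell a u v -> dcell b v u
}.

Section Decorated.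
Variables (C : bicategory) (D : decoration C).

Definition decorated_hom (x y : dob D) : Type :=
  {f : hom1 (dbase x) (dbase y) & dhom f}.

Definition decorated_cell (x y : dob D) (f g : decorated_hom x y) : Type :=
  {a : cell (projT1 f) (projT1 g) | dcell a (projT2 f) (projT2 g)}.

Lemma decorated_cell_eq (x y : dob D) (f g : decorated_hom x y)
    (a b : decorated_cell f g) : sval a = sval b -> a = b.
Proof.
case: a b => [a pa] [b pb] /= ab; rewrite ab in pa *.
by rewrite (Prop_irrelevance pa pb).
Qed.

Definition decorated : bicategory.
Proof.
apply: (@Bicategory (dob D) decorated_hom decorated_cell
  (fun x => existT _ (id1 (dbase x)) (did1 x))
  (fun x y z g f => existT _ (projT1 g \o1 projT1 f)
                             (dcomp1 (projT2 g) (projT2 f)))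
  (fun x y f => exist _ (id2 (projT1 f)) (did2 (projT2 f)))
  (fun x y f g h b a => exist _ (sval b \ov sval a)
                                (dvcomp (svalP b) (svalP a)))
  (fun x y z g g' f f' b a => exist _ (sval b \oh sval a)
                                      (dhcomp (svalP b) (svalP a)))
  (fun x y z w h g f => exist _ (assoc (projT1 h) (projT1 g) (projT1 f))
     (dassoc (projT2 h) (projT2 g) (projT2 f)))
  (fun x y z w h g f => exist _ (assocV (projT1 h) (projT1 g) (projT1 f))
     (dinv (assocK _ _ _) (dassoc (projT2 h) (projT2 g) (projT2 f))))
  (fun x y f => exist _ (lunit (projT1 f)) (dlunit (projT2 f)))
  (fun x y f => exist _ (lunitV (projT1 f))
     (dinv (lunitK _) (dlunit (projT2 f))))
  (fun x y f => exist _ (runit (projT1 f)) (drunit (projT2 f)))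
  (fun x y f => exist _ (runitV (projT1 f))
     (dinv (runitK _) (drunit (projT2 f))))).
- abstract (intros; apply: decorated_cell_eq; exact: vcompA).
- abstract (intros; apply: decorated_cell_eq; exact: vcomp1l).
- abstract (intros; apply: decorated_cell_eq; exact: vcomp1r).
- abstract (intros; apply: decorated_cell_eq; exact: hcomp_id).
- abstract (intros; apply: decorated_cell_eq; exact: hcomp_vcomp).
- abstract (intros; apply: decorated_cell_eq; exact: assoc_nat).
- abstract (intros; apply: decorated_cell_eq; exact: lunit_nat).
- abstract (intros; apply: decorated_cell_eq; exact: runit_nat).
- abstract (intros; apply: decorated_cell_eq; exact: assocK).
- abstract (intros; apply: decorated_cell_eq; exact: assocVK).
- abstract (intros; apply: decorated_cell_eq; exact: lunitK).
- abstract (intros; apply: decorated_cell_eq; exact: lunitVK).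
- abstract (intros; apply: decorated_cell_eq; exact: runitK).
- abstract (intros; apply: decorated_cell_eq; exact: runitVK).
- abstract (intros; apply: decorated_cell_eq; exact: pentagon).
- abstract (intros; apply: decorated_cell_eq; exact: triangle).
Defined.

Definition decorated_proj_lax : lax_functor decorated C.
Proof.
apply: (@LaxFunctor decorated C (@dbase C D) (fun x y f => projT1 f)
  (fun x y f g a => sval a) (fun x => id2 (id1 (dbase x)))
  (fun x y z g f => id2 (projT1 g \o1 projT1 f))).
- abstract (by []).
- abstract (by []).
- abstract (by move=> x y z g g' f f' b a; rewrite vcomp1l vcomp1r).
- abstract (by move=> x y z w h g f; rewrite !hcomp_id !vcomp1l vcomp1r).
- abstract (by move=> x y f; rewrite !hcomp_id !vcomp1r).
- abstract (by move=> x y f; rewrite !hcomp_id !vcomp1r).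
Defined.

Definition decorated_proj : pseudofunctor decorated C :=
  @Pseudofunctor decorated C decorated_proj_lax
    (fun x => id2_invertible _) (fun x y z g f => id2_invertible _).

End Decorated.

(* Unlike [falgType], this does not exclude the zero algebra. *)
Record fdalgebra (K : fieldType) := FdAlgebra {
  fdalg_car :> vectType K;
  amul : fdalg_car -> fdalg_car -> fdalg_car;
  aone : fdalg_car;
  amul_linl : forall b, linear (amul^~ b);
  amul_linr : forall a, linear (amul a);
  amulA : forall a b c, amul a (amul b c) = amul (amul a b) c;
  amul1l : forall a, amul aone a = a;
  amul1r : forall a, amul a aone = a
}.

Arguments aone {K} f.
Notation "a \am b" := (amul a b) (at level 40, left associativity).

Record rmodule (K : fieldType) (A : fdalgebra K) := RModule {
  rmod_car :> vectType K;
  ract : rmod_car -> A -> rmod_car;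
  ract_linl : forall a, linear (ract^~ a);
  ract_linr : forall m, linear (ract m);
  ract1 : forall m, ract m (aone A) = m;
  ractM : forall m a b, ract m (a \am b) = ract (ract m a) b
}.

Notation "m \ra a" := (ract m a) (at level 40, left associativity).

(* A (B, A)-bimodule; the two actions of [K] through [A] and through [B]
   agree with the scaling of the underlying vector space. *)
Record bimodule (K : fieldType) (B A : fdalgebra K) := Bimodule {
  bimod_rmod :> rmodule A;
  lact : B -> bimod_rmod -> bimod_rmod;
  lact_linl : forall m, linear (lact^~ m);
  lact_linr : forall b, linear (lact b);
  lact1 : forall m, lact (aone B) m = m;
  lactM : forall b c m, lact (b \am c) m = lact b (lact c m);
  lract : forall b m a, lact b m \ra a = lact b (m \ra a)
}.

Notation "b \la m" := (lact b m) (at level 40, left associativity).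

Record rmap (K : fieldType) (A : fdalgebra K) (M N : rmodule A) := RMap {
  rfun :> 'Hom(M, N);
  rfunP : forall m a, rfun (m \ra a) = rfun m \ra a
}.

Record bimap (K : fieldType) (B A : fdalgebra K) (M N : bimodule B A) :=
  BiMap {
  bmap_rmap :> rmap M N;
  bfunP : forall b m, bmap_rmap (b \la m) = b \la bmap_rmap m
}.

Section ModuleTheory.
Variable K : fieldType.
Implicit Types (A B C : fdalgebra K).

Lemma rmap_eq A (M N : rmodule A) (f g : rmap M N) : f =1 g -> f = g.
Proof.
case: f g => [f fP] [g gP] /= /lfunP fg; rewrite fg in fP *.
by rewrite (Prop_irrelevance fP gP).
Qed.

Lemma bimap_eq B A (M N : bimodule B A) (f g : bimap M N) : f =1 g -> f = g.
Proof.
case: f g => [f fP] [g gP] /= /rmap_eq fg; rewrite fg in fP *.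
by rewrite (Prop_irrelevance fP gP).
Qed.

Lemma ractDl A (M : rmodule A) (m n : M) a : (m + n) \ra a = m \ra a + n \ra a.
Proof. by have := ract_linl a 1 m n; rewrite !scale1r. Qed.

Lemma ractDr A (M : rmodule A) (m : M) a b : m \ra (a + b) = m \ra a + m \ra b.
Proof. by have := ract_linr m 1 a b; rewrite !scale1r. Qed.

Lemma lactDl B A (M : bimodule B A) (m : M) b c :
  (b + c) \la m = b \la m + c \la m.
Proof. by have := lact_linl m 1 b c; rewrite !scale1r. Qed.

Lemma lactDr B A (M : bimodule B A) (m n : M) b :
  b \la (m + n) = b \la m + b \la n.
Proof. by have := lact_linr b 1 m n; rewrite !scale1r. Qed.

Definition regular_rmod A : rmodule A :=
  @RModule K A A (@amul K A) (@amul_linl K A) (@amul_linr K A)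
    (@amul1r K A) (@amulA K A).

Definition regular A : bimodule A A :=
  @Bimodule K A A (regular_rmod A) (@amul K A)
    (@amul_linl K A) (@amul_linr K A) (@amul1l K A)
    (fun a b m => esym (amulA a b m)) (fun b m a => esym (amulA b m a)).

End ModuleTheory.

Lemma linear_vbasis (K : fieldType) (V W : vectType K) (f : V -> W) :
  linear f -> forall v, f v =
    \sum_(i < \dim {:V}) coord (vbasis {:V}) i v *: f (vbasis {:V})`_i.
Proof.
move=> fL v; pose g : {linear V -> W} :=
  HB.pack f (GRing.isLinear.Build _ _ _ _ _ fL).
rewrite {1}(coord_vbasis (memvf v)) -[f]/(g : V -> W) linear_sum.
by apply: eq_bigr => i _; rewrite linearZ.
Qed.

Section TensorSpace.
Variables (K : fieldType) (A B : fdalgebra K).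
Variables (M : rmodule A) (N : bimodule A B).

(* The tensor product of [M] and [N] over [K] is realised by matrices. *)
Let E := 'M[K]_(\dim {:M}, \dim {:N}).

Definition kpure (m : M) (n : N) : E :=
  \matrix_(i, j) (coord (vbasis {:M}) i m * coord (vbasis {:N}) j n).

Definition krel : {vspace E} :=
  (\sum_(i < \dim {:M}) \sum_(a < \dim {:A}) \sum_(j < \dim {:N})
    <[kpure ((vbasis {:M})`_i \ra (vbasis {:A})`_a) (vbasis {:N})`_j
      - kpure (vbasis {:M})`_i ((vbasis {:A})`_a \la (vbasis {:N})`_j)]>)%VS.

(* The quotient of [E] by [krel] is realised by a complement of [krel]. *)
Definition tens : vectType K := subvs_of (krel^C)%VS.

Definition tproj : 'Hom(E, tens) :=
  linfun (vsproj (krel^C)%VS \o daddv_pi (krel^C)%VS krel).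

Definition pure (m : M) (n : N) : tens := tproj (kpure m n).

Section Lift.
Variables (V : vectType K) (b : M -> N -> V).

Definition klift (X : E) : V :=
  \sum_(i < \dim {:M}) \sum_(j < \dim {:N})
    X i j *: b (vbasis {:M})`_i (vbasis {:N})`_j.

(* The map induced by [b]; see [tliftE] for its defining property. *)
Definition tlift : 'Hom(tens, V) := linfun (fun t : tens => klift (vsval t)).

Lemma klift_linear : linear klift.
Proof.
move=> k X Y; rewrite /klift scaler_sumr -big_split; apply: eq_bigr => i _ /=.
rewrite scaler_sumr -big_split; apply: eq_bigr => j _ /=.
by rewrite !mxE scalerDl scalerA.
Qed.

Lemma tlift_linear : linear (fun t : tens => klift (vsval t)).
Proof. by move=> k x y; rewrite linearP klift_linear. Qed.

Lemma tlift_vsval t : tlift t = klift (vsval t).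
Proof.
pose g : {linear tens -> V} := HB.pack (fun t : tens => klift (vsval t))
  (GRing.isLinear.Build _ _ _ _ _ tlift_linear).
exact: (lfunE g).
Qed.

Hypothesis b_linl : forall n, linear (b^~ n).
Hypothesis b_linr : forall m, linear (b m).

Lemma klift_kpure m n : klift (kpure m n) = b m n.
Proof.
rewrite (linear_vbasis (b_linl n)); apply: eq_bigr => i _.
rewrite (linear_vbasis (b_linr _)) scaler_sumr; apply: eq_bigr => j _.
by rewrite mxE scalerA.
Qed.

Hypothesis b_bal : forall m a n, b (m \ra a) n = b m (a \la n).

Lemma klift_krel X : X \in krel -> klift X = 0.
Proof.
pose g : {linear E -> V} := HB.pack klift
  (GRing.isLinear.Build _ _ _ _ _ klift_linear).
have gE Y : linfun g Y = klift Y by rewrite lfunE.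
suff /subvP sub : (krel <= lker (linfun g))%VS.
  by move=> /sub; rewrite memv_ker gE => /eqP.
apply/subv_sumP => i _; apply/subv_sumP => a _; apply/subv_sumP => j _.
by rewrite -memvE memv_ker lfunE linearB /= !klift_kpure b_bal subrr.
Qed.

Lemma krel_compl_cap : (krel^C :&: krel = 0)%VS.
Proof. by rewrite capvC capv_compl. Qed.

Lemma krel_pi_add (X : E) :
  daddv_pi (krel^C)%VS krel X + daddv_pi krel (krel^C)%VS X = X.
Proof.
apply: daddv_pi_add; first exact: krel_compl_cap.
by rewrite addvC addv_complf memvf.
Qed.

Lemma tliftE m n : tlift (pure m n) = b m n.
Proof.
rewrite tlift_vsval /pure lfunE /= vsprojK ?memv_pi //.
rewrite -klift_kpure -[in RHS](krel_pi_add (kpure m n)).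
have := klift_linear 1 (daddv_pi (krel^C)%VS krel (kpure m n))
  (daddv_pi krel (krel^C)%VS (kpure m n)).
by rewrite !scale1r [klift (daddv_pi krel _ _)]klift_krel ?memv_pi ?addr0.
Qed.

End Lift.

Lemma kpure_linl n : linear (kpure^~ n).
Proof.
by move=> k x y; apply/matrixP => i j; rewrite !mxE linearP mulrDl mulrA.
Qed.

Lemma kpure_linr m : linear (kpure m).
Proof.
move=> k x y; apply/matrixP => i j.
by rewrite !mxE linearP mulrDr mulrCA.
Qed.

Lemma linear_mem_basis (V W : vectType K) (U : {vspace W}) (f : V -> W) :
  linear f -> (forall i, f (vbasis {:V})`_i \in U) -> forall v, f v \in U.
Proof.
move=> fL fU v; rewrite (linear_vbasis fL).
by apply: memv_suml => i _; apply: memvZ.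
Qed.

Lemma kpure_bal m a n :
  kpure (m \ra a) n - kpure m (a \la n) \in krel.
Proof.
have Lm a' n' : linear (fun m' => kpure (m' \ra a') n' - kpure m' (a' \la n')).
  by move=> k x y; rewrite ract_linl !kpure_linl scalerBr opprD addrACA.
have La m' n' : linear (fun a' => kpure (m' \ra a') n' - kpure m' (a' \la n')).
  move=> k x y; rewrite ract_linr lact_linl kpure_linl kpure_linr.
  by rewrite scalerBr opprD addrACA.
have Ln m' a' : linear (fun n' => kpure (m' \ra a') n' - kpure m' (a' \la n')).
  by move=> k x y; rewrite lact_linr !kpure_linr scalerBr opprD addrACA.
have dim_lt (V : vectType K) i : (\dim {:V} <= i)%N -> (vbasis {:V})`_i = 0.
  by move=> le; rewrite nth_default // size_tuple.
have bas i x j : kpure ((vbasis {:M})`_i \ra (vbasis {:A})`_x) (vbasis {:N})`_j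
      - kpure (vbasis {:M})`_i ((vbasis {:A})`_x \la (vbasis {:N})`_j) \in krel.
  have lin0 (V W : vectType K) (f : V -> W) : linear f -> f 0 = 0.
    by move=> fL; have := fL (-1) 0 0; rewrite scaler0 addr0 scaleN1r addNr.
  case: (ltnP i (\dim {:M})) => [lti | /dim_lt ->]; last first.
    by rewrite (lin0 _ _ _ (Lm _ _)) mem0v.
  case: (ltnP x (\dim {:A})) => [ltx | /dim_lt ->]; last first.
    by rewrite (lin0 _ _ _ (La _ _)) mem0v.
  case: (ltnP j (\dim {:N})) => [ltj | /dim_lt ->]; last first.
    by rewrite (lin0 _ _ _ (Ln _ _)) mem0v.
  apply: (subvP (sumv_sup (Ordinal lti) _ (subvv _))) => //.
  apply: (subvP (sumv_sup (Ordinal ltx) _ (subvv _))) => //.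
  apply: (subvP (sumv_sup (Ordinal ltj) _ (subvv _))) => //.
  exact: memv_line.
apply: (linear_mem_basis (Lm _ _)) => i.
apply: (linear_mem_basis (La _ _)) => x.
apply: (linear_mem_basis (Ln _ _)) => j.
exact: bas.
Qed.

Lemma pure_linl n : linear (pure^~ n).
Proof. by move=> k x y; rewrite /pure kpure_linl linearP. Qed.

Lemma pure_linr m : linear (pure m).
Proof. by move=> k x y; rewrite /pure kpure_linr linearP. Qed.

Lemma pureDl m m' n : pure (m + m') n = pure m n + pure m' n.
Proof. by have := pure_linl n 1 m m'; rewrite !scale1r. Qed.

Lemma pureDr m n n' : pure m (n + n') = pure m n + pure m n'.
Proof. by have := pure_linr m 1 n n'; rewrite !scale1r. Qed.

Lemma pure0l n : pure 0 n = 0.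
Proof.
by have := pure_linl n (-1) 0 0; rewrite scaler0 addr0 scaleN1r addNr.
Qed.

Lemma pureZl k m n : pure (k *: m) n = k *: pure m n.
Proof. by have := pure_linl n k m 0; rewrite pure0l !addr0. Qed.

Lemma pure_bal m a n : pure (m \ra a) n = pure m (a \la n).
Proof.
apply/eqP; rewrite -subr_eq0 /pure -linearB /= lfunE /=.
set X := _ - _; have XR : X \in krel by apply: kpure_bal.
have := krel_pi_add X; rewrite [daddv_pi krel _ X]daddv_pi_id ?capv_compl //.
by move/(canRL (addrK _)); rewrite subrr => ->; rewrite linear0.
Qed.

Lemma tens_ind (P : tens -> Prop) :
  (forall m n, P (pure m n)) -> (forall s t, P s -> P t -> P (s + t)) ->
  forall t, P t.
Proof.
move=> P1 PD t.
have P0 : P 0 by rewrite -(pure0l 0).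
have -> : t = \sum_(i < \dim {:M}) \sum_(j < \dim {:N})
    pure (vsval t i j *: (vbasis {:M})`_i) (vbasis {:N})`_j.
  have {1}-> : t = tproj (vsval t).
    rewrite lfunE /= daddv_pi_id ?subvsP ?krel_compl_cap //.
    by rewrite vsvalK.
  rewrite {1}[vsval t]matrix_sum_delta linear_sum.
  apply: eq_bigr => i _; rewrite linear_sum; apply: eq_bigr => j _.
  rewrite pureZl linearZ /=; congr (_ *: tproj _).
  apply/matrixP => i' j'; rewrite !mxE.
  rewrite !coord_free ?(basis_free (vbasisP _)) //.
  by rewrite -natrM mulnb eq_sym [j' == _]eq_sym.
elim/big_ind: _ => // i _; exact: big_ind.
Qed.

Lemma tens_lfun_eq (V : vectType K) (f g : 'Hom(tens, V)) :
  (forall m n, f (pure m n) = g (pure m n)) -> f =1 g.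
Proof.
move=> fg; elim/tens_ind => [m n | s t es et]; first exact: fg.
by rewrite !linearD /= es et.
Qed.

End TensorSpace.

Notation "m \ox n" := (pure m n) (at level 40, left associativity).

Section TensorModules.
Variable K : fieldType.
Implicit Types (A B C D : fdalgebra K).

Lemma lfunD (V W : vectType K) (f : 'Hom(V, W)) x y : f (x + y) = f x + f y.
Proof. exact: linearD. Qed.

Section Actions.
Variables (C A B : fdalgebra K).

Section Right.
Variables (M : rmodule A) (N : bimodule A B).

Definition tens_ract (t : tens M N) (b : B) : tens M N :=
  tlift (fun m n => m \ox (n \ra b)) t.

Lemma tens_ractE m n b : tens_ract (m \ox n) b = m \ox (n \ra b).
Proof.
rewrite /tens_ract tliftE // => [n' k x y | m' k x y | m' a n'].
- exact: pure_linl.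
- by rewrite ract_linl pure_linr.
- by rewrite pure_bal lract.
Qed.

Lemma tens_ract_linl b : linear (tens_ract^~ b).
Proof. by move=> k s t; rewrite /tens_ract linearP. Qed.

Lemma tens_ractDl s t b : tens_ract (s + t) b = tens_ract s b + tens_ract t b.
Proof. exact: linearD. Qed.

Lemma tens_ract_linr t : linear (tens_ract t).
Proof.
elim/tens_ind: t => [m n | s t IHs IHt] k x y.
  by rewrite !tens_ractE ract_linr pure_linr.
by rewrite !tens_ractDl IHs IHt scalerDr addrACA.
Qed.

Lemma tens_ract1 t : tens_ract t (aone B) = t.
Proof.
elim/tens_ind: t => [m n | s t IHs IHt]; first by rewrite tens_ractE ract1.
by rewrite tens_ractDl IHs IHt.
Qed.

Lemma tens_ractM t x y : tens_ract t (x \am y) = tens_ract (tens_ract t x) y.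
Proof.
elim/tens_ind: t => [m n | s t IHs IHt].
  by rewrite !tens_ractE ractM.
by rewrite !tens_ractDl IHs IHt.
Qed.

Definition rtens : rmodule B :=
  RModule tens_ract_linl tens_ract_linr tens_ract1 tens_ractM.

Lemma pure_ract m n b : (m \ox n : rtens) \ra b = m \ox (n \ra b).
Proof. exact: tens_ractE. Qed.

End Right.

Section Left.
Variables (M : bimodule C A) (N : bimodule A B).

Definition tens_lact (c : C) (t : rtens M N) : rtens M N :=
  tlift (fun m n => (c \la m) \ox n) t.

Lemma tens_lactE c m n : tens_lact c (m \ox n) = (c \la m) \ox n.
Proof.
rewrite /tens_lact tliftE // => [n' k x y | m' k x y | m' a n'].
- by rewrite lact_linr pure_linl.
- exact: pure_linr.
- by rewrite -lract pure_bal.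
Qed.

Lemma tens_lact_linr c : linear (tens_lact c).
Proof. by move=> k s t; rewrite /tens_lact linearP. Qed.

Lemma tens_lactDr c s t : tens_lact c (s + t) = tens_lact c s + tens_lact c t.
Proof. exact: linearD. Qed.

Lemma tens_lact_linl t : linear (tens_lact^~ t).
Proof.
elim/tens_ind: t => [m n | s t IHs IHt] k x y.
  by rewrite !tens_lactE lact_linl pure_linl.
by rewrite !tens_lactDr IHs IHt scalerDr addrACA.
Qed.

Lemma tens_lact1 t : tens_lact (aone C) t = t.
Proof.
elim/tens_ind: t => [m n | s t IHs IHt]; first by rewrite tens_lactE lact1.
by rewrite tens_lactDr IHs IHt.
Qed.

Lemma tens_lactM x y t : tens_lact (x \am y) t = tens_lact x (tens_lact y t).
Proof.
elim/tens_ind: t => [m n | s t IHs IHt].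
  by rewrite !tens_lactE lactM.
by rewrite !tens_lactDr IHs IHt.
Qed.

Lemma tens_lract c t b : tens_lact c t \ra b = tens_lact c (t \ra b).
Proof.
elim/tens_ind: t => [m n | s t IHs IHt].
  by rewrite pure_ract !tens_lactE pure_ract.
by rewrite ractDl !tens_lactDr ractDl IHs IHt.
Qed.

Definition btens : bimodule C B :=
  Bimodule tens_lact_linl tens_lact_linr tens_lact1 tens_lactM tens_lract.

Lemma pure_lact c m n : c \la (m \ox n : btens) = (c \la m) \ox n.
Proof. exact: tens_lactE. Qed.

End Left.
End Actions.

Arguments rtens : simpl never.
Arguments btens : simpl never.

Section Maps.
Variables (C A B : fdalgebra K).

Section Right.
Variables (M M' : rmodule A) (N N' : bimodule A B).
Variables (f : rmap M M') (g : bimap N N').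

Definition tmap : 'Hom(tens M N, tens M' N') :=
  tlift (fun m n => f m \ox g n).

Lemma tmapE m n : tmap (m \ox n) = f m \ox g n.
Proof.
rewrite /tmap tliftE // => [n' k x y | m' k x y | m' a n'].
- by rewrite linearP pure_linl.
- by rewrite linearP pure_linr.
- by rewrite rfunP bfunP pure_bal.
Qed.

Lemma tmap_ract (t : rtens M N) b :
  tmap (t \ra b) = (tmap t : rtens M' N') \ra b.
Proof.
elim/tens_ind: t => [m n | s t IHs IHt].
  by rewrite tmapE !pure_ract tmapE rfunP.
by rewrite ractDl !lfunD IHs IHt ractDl.
Qed.

Definition rtmap : rmap (rtens M N) (rtens M' N') :=
  @RMap K B (rtens M N) (rtens M' N') tmap tmap_ract.

Lemma rtmapE m n : rtmap (m \ox n) = f m \ox g n.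
Proof. exact: tmapE. Qed.

End Right.

Section Left.
Variables (M M' : bimodule C A) (N N' : bimodule A B).
Variables (f : bimap M M') (g : bimap N N').

Lemma tmap_lact c (t : btens M N) :
  rtmap f g (c \la t) = c \la (rtmap f g t : btens M' N').
Proof.
elim/tens_ind: t => [m n | s t IHs IHt].
  by rewrite pure_lact !rtmapE bfunP -pure_lact.
by rewrite lactDr !lfunD IHs IHt lactDr.
Qed.

Definition btmap : bimap (btens M N) (btens M' N') :=
  @BiMap K C B (btens M N) (btens M' N') (rtmap f g) tmap_lact.

Lemma btmapE m n : btmap (m \ox n) = f m \ox g n.
Proof. exact: tmapE. Qed.

End Left.
End Maps.

Section Assoc.
Variables (D C A B : fdalgebra K).

Section Right.
Variables (L : rmodule C) (M : bimodule C A) (N : bimodule A B).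

Definition tassoc : 'Hom(tens (rtens L M) N, tens L (btens M N)) :=
  tlift (M := rtens L M) (N := N) (fun (t : tens L M) n =>
    tlift (M := L) (N := M) (fun l m => l \ox (m \ox n : btens M N)) t).

Lemma tassoc_subE n l m :
  tlift (M := L) (N := M) (fun l m => l \ox (m \ox n : btens M N)) (l \ox m)
  = l \ox (m \ox n : btens M N).
Proof.
rewrite tliftE // => [m' k x y | l' k x y | l' c m'].
- exact: pure_linl.
- by rewrite pure_linl pure_linr.
- by rewrite pure_bal pure_lact.
Qed.

Lemma tassocE l m n :
  tassoc ((l \ox m : rtens L M) \ox n) = l \ox (m \ox n : btens M N).
Proof.
rewrite /tassoc tliftE ?tassoc_subE // => [n' k x y | t k x y | t a n'].
- by rewrite linearP.
- elim/tens_ind: t => [l' m' | s t IHs IHt].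
    by rewrite !tassoc_subE !pure_linr.
  by rewrite !lfunD IHs IHt scalerDr addrACA.
- elim/tens_ind: t => [l' m' | s t IHs IHt].
    by rewrite pure_ract !tassoc_subE pure_bal.
  by rewrite ractDl !lfunD IHs IHt.
Qed.

Definition tassocV : 'Hom(tens L (btens M N), tens (rtens L M) N) :=
  tlift (M := L) (N := btens M N) (fun l (t : tens M N) =>
    tlift (M := M) (N := N) (fun m n => (l \ox m : rtens L M) \ox n) t).

Lemma tassocV_subE l m n :
  tlift (M := M) (N := N) (fun m n => (l \ox m : rtens L M) \ox n) (m \ox n)
  = (l \ox m : rtens L M) \ox n.
Proof.
rewrite tliftE // => [n' k x y | m' k x y | m' a n'].
- by rewrite pure_linr pure_linl.
- exact: pure_linr.
- by rewrite -pure_bal pure_ract.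
Qed.

Lemma tassocVE l m n :
  tassocV (l \ox (m \ox n : btens M N)) = (l \ox m : rtens L M) \ox n.
Proof.
rewrite /tassocV tliftE ?tassocV_subE // => [t k x y | l' k x y | l' c t].
- elim/tens_ind: t => [m' n' | s t IHs IHt].
    by rewrite !tassocV_subE !pure_linl.
  by rewrite !lfunD IHs IHt scalerDr addrACA.
- by rewrite linearP.
- elim/tens_ind: t => [m' n' | s t IHs IHt].
    by rewrite pure_lact !tassocV_subE pure_bal.
  by rewrite lactDr !lfunD IHs IHt.
Qed.

Lemma tens3_ind (P : tens (rtens L M) N -> Prop) :
  (forall l m n, P ((l \ox m : rtens L M) \ox n)) ->
  (forall s t, P s -> P t -> P (s + t)) -> forall t, P t.
Proof.
move=> P1 PD; elim/tens_ind => // t n.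
by elim/tens_ind: t => // s t Ps Pt; rewrite pureDl; apply: PD.
Qed.

Lemma tens3V_ind (P : tens L (btens M N) -> Prop) :
  (forall l m n, P (l \ox (m \ox n : btens M N))) ->
  (forall s t, P s -> P t -> P (s + t)) -> forall t, P t.
Proof.
move=> P1 PD; elim/tens_ind => // l t.
by elim/tens_ind: t => // s t Ps Pt; rewrite pureDr; apply: PD.
Qed.

Lemma tassoc_ract (t : rtens (rtens L M) N) b :
  tassoc (t \ra b) = (tassoc t : rtens L (btens M N)) \ra b.
Proof.
elim/tens3_ind: t => [l m n | s t IHs IHt].
  by rewrite tassocE !pure_ract tassocE.
by rewrite ractDl !lfunD IHs IHt ractDl.
Qed.

Lemma tassocV_ract (t : rtens L (btens M N)) b :
  tassocV (t \ra b) = (tassocV t : rtens (rtens L M) N) \ra b.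
Proof.
elim/tens3V_ind: t => [l m n | s t IHs IHt].
  by rewrite tassocVE !pure_ract tassocVE.
by rewrite ractDl !lfunD IHs IHt ractDl.
Qed.

Definition rassoc : rmap (rtens (rtens L M) N) (rtens L (btens M N)) :=
  @RMap K B (rtens (rtens L M) N) (rtens L (btens M N)) tassoc tassoc_ract.
Definition rassocV : rmap (rtens L (btens M N)) (rtens (rtens L M) N) :=
  @RMap K B (rtens L (btens M N)) (rtens (rtens L M) N) tassocV tassocV_ract.

Lemma rassocE l m n :
  rassoc ((l \ox m : rtens L M) \ox n) = l \ox (m \ox n : btens M N).
Proof. exact: tassocE. Qed.

Lemma rassocVE l m n :
  rassocV (l \ox (m \ox n : btens M N)) = (l \ox m : rtens L M) \ox n.
Proof. exact: tassocVE. Qed.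

End Right.

Section Left.
Variables (L : bimodule D C) (M : bimodule C A) (N : bimodule A B).

Lemma tassoc_lact d (t : btens (btens L M) N) :
  rassoc L M N (d \la t) = d \la (rassoc L M N t : btens L (btens M N)).
Proof.
elim/tens3_ind: t => [l m n | s t IHs IHt].
  by rewrite !pure_lact !rassocE !pure_lact.
by rewrite lactDr !lfunD IHs IHt lactDr.
Qed.

Lemma tassocV_lact d (t : btens L (btens M N)) :
  rassocV L M N (d \la t) = d \la (rassocV L M N t : btens (btens L M) N).
Proof.
elim/tens3V_ind: t => [l m n | s t IHs IHt].
  by rewrite !pure_lact !rassocVE !pure_lact.
by rewrite lactDr !lfunD IHs IHt lactDr.
Qed.

Definition bassoc : bimap (btens (btens L M) N) (btens L (btens M N)) :=
  @BiMap K D B (btens (btens L M) N) (btens L (btens M N)) (rassoc L M N)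
    tassoc_lact.
Definition bassocV : bimap (btens L (btens M N)) (btens (btens L M) N) :=
  @BiMap K D B (btens L (btens M N)) (btens (btens L M) N) (rassocV L M N)
    tassocV_lact.

Lemma bassocE l m n :
  bassoc ((l \ox m : btens L M) \ox n) = l \ox (m \ox n : btens M N).
Proof. exact: tassocE. Qed.

Lemma bassocVE l m n :
  bassocV (l \ox (m \ox n : btens M N)) = (l \ox m : btens L M) \ox n.
Proof. exact: tassocVE. Qed.

End Left.
End Assoc.

Section LeftUnit.
Variables (B A : fdalgebra K) (M : bimodule B A).

Definition tlunit : 'Hom(tens (regular B) M, M) := 
  tlift (M := regular B) (N := M) (fun (b : B) m => b \la m).

Lemma tlunitE b m : tlunit (b \ox m) = b \la m.
Proof.
rewrite /tlunit tliftE // => [n' k x y | m' k x y | m' a n'].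
- exact: lact_linl.
- exact: lact_linr.
- exact: lactM.
Qed.

Lemma tlunit_ract (t : btens (regular B) M) a :
  tlunit (t \ra a) = tlunit t \ra a.
Proof.
elim/tens_ind: t => [b m | s t IHs IHt].
  by rewrite pure_ract !tlunitE lract.
by rewrite ractDl !lfunD IHs IHt ractDl.
Qed.

Lemma tlunit_lact b (t : btens (regular B) M) :
  tlunit (b \la t) = b \la tlunit t.
Proof.
elim/tens_ind: t => [b' m | s t IHs IHt].
  by rewrite pure_lact !tlunitE lactM.
by rewrite lactDr !lfunD IHs IHt lactDr.
Qed.

Definition blunit : bimap (btens (regular B) M) M :=
  @BiMap K B A (btens (regular B) M) M
    (@RMap K A (btens (regular B) M) M tlunit tlunit_ract) tlunit_lact.

Lemma blunitE b m : blunit (b \ox m) = b \la m.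
Proof. exact: tlunitE. Qed.

Definition tlunitV : 'Hom(M, tens (regular B) M) :=
  linfun (fun m => (aone B : regular B) \ox m).

Lemma tlunitVE m : tlunitV m = (aone B : regular B) \ox m.
Proof.
pose g : {linear M -> tens (regular B) M} :=
  HB.pack (fun m : M => (aone B : regular B) \ox m)
    (GRing.isLinear.Build _ _ _ _ _ (@pure_linr K B A (regular B) M (aone B))).
exact: (lfunE g).
Qed.

Lemma tlunitV_ract m a :
  tlunitV (m \ra a) = (tlunitV m : btens (regular B) M) \ra a.
Proof. by rewrite !tlunitVE pure_ract. Qed.

Lemma tlunitV_lact b m :
  tlunitV (b \la m) = b \la (tlunitV m : btens (regular B) M).
Proof. by rewrite !tlunitVE pure_lact -pure_bal /= amul1l amul1r. Qed.

Definition blunitV : bimap M (btens (regular B) M) :=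
  @BiMap K B A M (btens (regular B) M)
    (@RMap K A M (btens (regular B) M) tlunitV tlunitV_ract) tlunitV_lact.

Lemma blunitVE m : blunitV m = (aone B : regular B) \ox m.
Proof. exact: tlunitVE. Qed.

End LeftUnit.

Section RightUnit.
Variables (B A : fdalgebra K).

Section Right.
Variable M : rmodule A.

Definition trunit : 'Hom(tens M (regular A), M) :=
  tlift (M := M) (N := regular A) (fun m (a : A) => m \ra a).

Lemma trunitE m a : trunit (m \ox a) = m \ra a.
Proof.
rewrite /trunit tliftE // => [n' k x y | m' k x y | m' a' n'].
- exact: ract_linl.
- exact: ract_linr.
- by rewrite -ractM.
Qed.

Lemma trunit_ract (t : rtens M (regular A)) a :
  trunit (t \ra a) = trunit t \ra a.
Proof.
elim/tens_ind: t => [m b | s t IHs IHt].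
  by rewrite pure_ract !trunitE ractM.
by rewrite ractDl !lfunD IHs IHt ractDl.
Qed.

Definition rrunit : rmap (rtens M (regular A)) M :=
  @RMap K A (rtens M (regular A)) M trunit trunit_ract.

Definition trunitV : 'Hom(M, tens M (regular A)) :=
  linfun (fun m => m \ox (aone A : regular A)).

Lemma trunitVE m : trunitV m = m \ox (aone A : regular A).
Proof.
pose g : {linear M -> tens M (regular A)} :=
  HB.pack (fun m : M => m \ox (aone A : regular A))
    (GRing.isLinear.Build _ _ _ _ _ (@pure_linl K A A M (regular A) (aone A))).
exact: (lfunE g).
Qed.

Lemma trunitV_ract m a :
  trunitV (m \ra a) = (trunitV m : rtens M (regular A)) \ra a.
Proof. by rewrite !trunitVE pure_ract pure_bal /= amul1l amul1r. Qed.

Definition rrunitV : rmap M (rtens M (regular A)) :=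
  @RMap K A M (rtens M (regular A)) trunitV trunitV_ract.

Lemma rrunitVE m : rrunitV m = m \ox (aone A : regular A).
Proof. exact: trunitVE. Qed.

End Right.

Variable M : bimodule B A.

Lemma trunit_lact b (t : btens M (regular A)) :
  rrunit M (b \la t) = b \la rrunit M t.
Proof.
elim/tens_ind: t => [m a | s t IHs IHt].
  by rewrite pure_lact !trunitE lract.
by rewrite lactDr !lfunD IHs IHt lactDr.
Qed.

Definition brunit : bimap (btens M (regular A)) M :=
  @BiMap K B A (btens M (regular A)) M (rrunit M) trunit_lact.

Lemma brunitE m a : brunit (m \ox a) = m \ra a.
Proof. exact: trunitE. Qed.

Lemma trunitV_lact b m :
  rrunitV M (b \la m) = b \la (rrunitV M m : btens M (regular A)).
Proof. by rewrite !trunitVE pure_lact. Qed.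

Definition brunitV : bimap M (btens M (regular A)) :=
  @BiMap K B A M (btens M (regular A)) (rrunitV M) trunitV_lact.

Lemma brunitVE m : brunitV m = m \ox (aone A : regular A).
Proof. exact: trunitVE. Qed.

End RightUnit.

Section Category.
Variables (B A : fdalgebra K).

Lemma rmap_id_subproof (M : rmodule A) (m : M) a :
  (\1%VF : 'Hom(M, M)) (m \ra a) = (\1%VF : 'Hom(M, M)) m \ra a.
Proof. by rewrite !id_lfunE. Qed.

Definition rmap_id (M : rmodule A) : rmap M M := RMap (@rmap_id_subproof M).

Lemma rmap_comp_subproof (M N P : rmodule A) (g : rmap N P) (f : rmap M N)
    m a :
  (g \o f)%VF (m \ra a) = (g \o f)%VF m \ra a.
Proof. by rewrite !comp_lfunE /= !rfunP. Qed.

Definition rmap_comp (M N P : rmodule A) (g : rmap N P) (f : rmap M N) :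
    rmap M P :=
  RMap (rmap_comp_subproof g f).

Lemma bimap_id_subproof (M : bimodule B A) b m :
  rmap_id M (b \la m) = b \la rmap_id M m.
Proof. by rewrite !id_lfunE. Qed.

Definition bimap_id (M : bimodule B A) : bimap M M :=
  BiMap (@bimap_id_subproof M).

Lemma bimap_comp_subproof (M N P : bimodule B A) (g : bimap N P)
    (f : bimap M N) b m :
  rmap_comp g f (b \la m) = b \la rmap_comp g f m.
Proof. by rewrite !comp_lfunE /= !bfunP. Qed.

Definition bimap_comp (M N P : bimodule B A) (g : bimap N P) (f : bimap M N) :
    bimap M P :=
  BiMap (bimap_comp_subproof g f).

Lemma rmap_idE (M : rmodule A) m : rmap_id M m = m.
Proof. exact: id_lfunE. Qed.

Lemma rmap_compE (M N P : rmodule A) (g : rmap N P) (f : rmap M N) m :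
  rmap_comp g f m = g (f m).
Proof. exact: comp_lfunE. Qed.

Lemma bimap_idE (M : bimodule B A) m : bimap_id M m = m.
Proof. exact: id_lfunE. Qed.

Lemma bimap_compE (M N P : bimodule B A) (g : bimap N P) (f : bimap M N) m :
  bimap_comp g f m = g (f m).
Proof. exact: comp_lfunE. Qed.

End Category.
End TensorModules.

Definition morita (K : fieldType) : bicategory.
Proof.
apply: (@Bicategory (fdalgebra K)
  (fun A0 A1 => bimodule A1 A0)
  (fun A0 A1 M N => bimap M N)
  (fun A => regular A)
  (fun A0 A1 A2 M21 M10 => btens M21 M10)
  (fun A0 A1 M => bimap_id M)
  (fun A0 A1 M N P g f => bimap_comp g f)
  (fun A0 A1 A2 M M' N N' f g => btmap f g)
  (fun A0 A1 A2 A3 L M N => bassoc L M N)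
  (fun A0 A1 A2 A3 L M N => bassocV L M N)
  (fun A0 A1 M => blunit M) (fun A0 A1 M => blunitV M)
  (fun A0 A1 M => brunit M) (fun A0 A1 M => brunitV M)).
- abstract (intros; apply: bimap_eq => m; by rewrite /= !comp_lfunE).
- abstract (intros; apply: bimap_eq => m;
    by rewrite /= !comp_lfunE id_lfunE).
- abstract (intros; apply: bimap_eq => m;
    by rewrite /= !comp_lfunE id_lfunE).
- abstract (intros; apply/bimap_eq/tens_lfun_eq => m n;
    by rewrite /= tmapE !id_lfunE).
- abstract (intros; apply/bimap_eq/tens_lfun_eq => m n;
    by rewrite /= !(comp_lfunE, tmapE)).
- abstract (intros; apply: bimap_eq;
    elim/tens3_ind => [l m n | s t IHs IHt]; last (by rewrite !lfunD IHs IHt);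
    by rewrite /= !(comp_lfunE, tmapE, tassocE)).
- abstract (intros; apply/bimap_eq/tens_lfun_eq => m n;
    by rewrite /= !(comp_lfunE, tmapE, tlunitE) /= id_lfunE bfunP).
- abstract (intros; apply/bimap_eq/tens_lfun_eq => m n;
    by rewrite /= !(comp_lfunE, tmapE, trunitE) /= id_lfunE rfunP).
- abstract (intros; apply: bimap_eq;
    elim/tens3_ind => [l m n | s t IHs IHt]; last (by rewrite !lfunD IHs IHt);
    by rewrite /= !(comp_lfunE, id_lfunE, tassocE, tassocVE)).
- abstract (intros; apply: bimap_eq;
    elim/tens3V_ind => [l m n | s t IHs IHt]; last (by rewrite !lfunD IHs IHt);
    by rewrite /= !(comp_lfunE, id_lfunE, tassocVE, tassocE)).
- abstract (intros; apply/bimap_eq/tens_lfun_eq => b m;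
    rewrite /= !(comp_lfunE, id_lfunE, tlunitE, tlunitVE);
    by rewrite -pure_bal /= amul1l).
- abstract (intros; apply: bimap_eq => m;
    by rewrite /= !(comp_lfunE, id_lfunE, tlunitVE, tlunitE) lact1).
- abstract (intros; apply/bimap_eq/tens_lfun_eq => m a;
    rewrite /= !(comp_lfunE, id_lfunE, trunitE, trunitVE);
    by rewrite pure_bal /= amul1r).
- abstract (intros; apply: bimap_eq => m;
    by rewrite /= !(comp_lfunE, id_lfunE, trunitVE, trunitE) ract1).
- abstract (intros; apply: bimap_eq;
    elim/tens_ind => [t n | s t IHs IHt]; last (by rewrite !lfunD IHs IHt);
    elim/tens3_ind: t => [p l m | s t IHs IHt];
    last (by rewrite pureDl !lfunD IHs IHt);
    by rewrite /= !(comp_lfunE, id_lfunE, tmapE, tassocE)).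
- abstract (intros; apply: bimap_eq;
    elim/tens3_ind => [l m n | s t IHs IHt]; last (by rewrite !lfunD IHs IHt);
    rewrite /= !(comp_lfunE, id_lfunE, tmapE, tassocE, trunitE, tlunitE);
    by rewrite pure_bal).
Defined.

Section Extensions.
Variables (K : fieldType) (C : bicategory) (J : lax_functor C (morita K)).

(* The values of [J], typed as algebras, bimodules and bimodule maps. *)
Definition Jalg (X : C) : fdalgebra K := J X.
Definition Jmod (X Y : C) (f : hom1 X Y) : bimodule (Jalg Y) (Jalg X) := F1 J f.
Definition Jmap (X Y : C) (f g : hom1 X Y) (a : cell f g) :
  bimap (Jmod f) (Jmod g) := F2 J a.
Definition Junit (X : C) : bimap (regular (Jalg X)) (Jmod (id1 X)) :=
  lax_id J X.
Definition Jmul (X Y Z : C) (g : hom1 Y Z) (f : hom1 X Y) :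
  bimap (btens (Jmod g) (Jmod f)) (Jmod (g \o1 f)) := lax_comp J g f.
Definition Jsimplex (X Y Z : C) (g : hom1 Y Z) (f : hom1 X Y) (h : hom1 X Z)
  (s : cell (g \o1 f) h) : bimap (btens (Jmod g) (Jmod f)) (Jmod h) :=
  F_simplex J s.

Lemma Jmap_id (X Y : C) (f : hom1 X Y) m : Jmap (id2 f) m = m.
Proof. by rewrite /Jmap F2_id; apply: bimap_idE. Qed.

Lemma Jmap_vcomp (X Y : C) (f g h : hom1 X Y) (b : cell g h) (a : cell f g) m :
  Jmap (b \ov a) m = Jmap b (Jmap a m).
Proof. by rewrite /Jmap F2_vcomp; apply: bimap_compE. Qed.

Lemma JsimplexE (X Y Z : C) (g : hom1 Y Z) (f : hom1 X Y) (h : hom1 X Z)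
    (s : cell (g \o1 f) h) t :
  Jsimplex s t = Jmap s (Jmul g f t).
Proof. exact: bimap_compE. Qed.

Lemma bimap_eqE (B A : fdalgebra K) (M N : bimodule B A) (f g : bimap M N) :
  f = g -> f =1 g.
Proof. by move=> ->. Qed.

Lemma Jmul_nat (X Y Z : C) (g g' : hom1 Y Z) (f f' : hom1 X Y)
    (b : cell g g') (a : cell f f') n m :
  Jmap (b \oh a) (Jmul g f (n \ox m)) = Jmul g' f' (Jmap b n \ox Jmap a m).
Proof.
have /bimap_eqE/(_ (n \ox m)) := lax_comp_nat J b a.
by rewrite !bimap_compE btmapE.
Qed.

Lemma Jmul_assoc (X Y Z W : C) (h : hom1 Z W) (g : hom1 Y Z) (f : hom1 X Y)
    p n m :
  Jmap (assoc h g f) (Jmul (h \o1 g) f (Jmul h g (p \ox n) \ox m))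
  = Jmul h (g \o1 f) (p \ox Jmul g f (n \ox m)).
Proof.
have /bimap_eqE/(_ ((p \ox n : btens (Jmod h) (Jmod g)) \ox m)) :=
  lax_assoc J h g f.
by rewrite !bimap_compE bassocE !btmapE !bimap_idE.
Qed.

Lemma Jmul_lunit (X Y : C) (f : hom1 X Y) b m :
  Jmap (lunit f) (Jmul (id1 Y) f (Junit Y b \ox m)) = b \la m.
Proof.
have /bimap_eqE/(_ ((b : regular (Jalg Y)) \ox m)) := lax_lunit J f.
by rewrite !bimap_compE btmapE bimap_idE blunitE.
Qed.

Lemma Jmul_runit (X Y : C) (f : hom1 X Y) m a :
  Jmap (runit f) (Jmul f (id1 X) (m \ox Junit X a)) = m \ra a.
Proof.
have /bimap_eqE/(_ (m \ox (a : regular (Jalg X)))) := lax_runit J f.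
by rewrite !bimap_compE btmapE bimap_idE brunitE.
Qed.

Definition st_cell (X Y : C) (f g : hom1 X Y) (a : cell f g)
    (u : Jmod f) (v : Jmod g) : Prop :=
  Jmap a u = v.

Definition st_id1 (X : C) : Jmod (id1 X) := Junit X (aone (Jalg X)).

Definition st_comp1 (X Y Z : C) (g : hom1 Y Z) (f : hom1 X Y)
    (v : Jmod g) (u : Jmod f) : Jmod (g \o1 f) :=
  Jmul g f (v \ox u).

(* The 2-cells from a composite are the 2-simplices [s] of [C] whose edges are
   decorated in such a way that [J(s)(v \ox u) = w]. *)
Lemma st_simplexP (X Y Z : C) (g : hom1 Y Z) (f : hom1 X Y) (h : hom1 X Z)
    (s : cell (g \o1 f) h) (v : Jmod g) (u : Jmod f) (w : Jmod h) :
  st_cell s (st_comp1 v u) w <-> Jsimplex s (v \ox u) = w.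
Proof. by rewrite JsimplexE. Qed.

Lemma st_did2 (X Y : C) (f : hom1 X Y) (u : Jmod f) : Jmap (id2 f) u = u.
Proof. exact: Jmap_id. Qed.

Lemma st_dvcomp (X Y : C) (f g h : hom1 X Y) (b : cell g h) (a : cell f g)
    (u : Jmod f) (v : Jmod g) (w : Jmod h) :
  Jmap b v = w -> Jmap a u = v -> Jmap (b \ov a) u = w.
Proof. by move=> <- <-; rewrite Jmap_vcomp. Qed.

Lemma st_dhcomp (X Y Z : C) (g g' : hom1 Y Z) (f f' : hom1 X Y)
    (b : cell g g') (a : cell f f')
    (v : Jmod g) (v' : Jmod g') (u : Jmod f) (u' : Jmod f') :
  Jmap b v = v' -> Jmap a u = u' ->
  Jmap (b \oh a) (Jmul g f (v \ox u)) = Jmul g' f' (v' \ox u').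
Proof. by move=> <- <-; rewrite Jmul_nat. Qed.

Lemma st_dlunit (X Y : C) (f : hom1 X Y) (u : Jmod f) :
  Jmap (lunit f) (Jmul (id1 Y) f (Junit Y (aone (Jalg Y)) \ox u)) = u.
Proof. by rewrite Jmul_lunit lact1. Qed.

Lemma st_drunit (X Y : C) (f : hom1 X Y) (u : Jmod f) :
  Jmap (runit f) (Jmul f (id1 X) (u \ox Junit X (aone (Jalg X)))) = u.
Proof. by rewrite Jmul_runit ract1. Qed.

Lemma st_dinv (X Y : C) (f g : hom1 X Y) (a : cell f g) (b : cell g f)
    (u : Jmod f) (v : Jmod g) :
  b \ov a = id2 f -> Jmap a u = v -> Jmap b v = u.
Proof. by move=> ba <-; rewrite -Jmap_vcomp ba Jmap_id. Qed.

Definition st_decoration : decoration C :=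
  @Decoration C C (fun X => X) (fun X Y f => Jmod f) st_cell st_id1 st_comp1
    st_did2 st_dvcomp st_dhcomp
    (fun X Y Z W h g f t v u => Jmul_assoc t v u)
    st_dlunit st_drunit st_dinv.

Definition st_bicat : bicategory := decorated st_decoration.

Definition st_proj : pseudofunctor st_bicat C := decorated_proj st_decoration.

Record ext_ob := ExtOb {
  ext_base : C;
  ext_mod : rmodule (Jalg ext_base)
}.

Definition ext_hom (x y : ext_ob) (f : hom1 (ext_base x) (ext_base y)) : Type :=
  rmap (ext_mod x) (rtens (ext_mod y) (Jmod f)).

Definition ext_cell (x y : ext_ob) (f g : hom1 (ext_base x) (ext_base y))
    (a : cell f g) (p : ext_hom f) (q : ext_hom g) : Prop :=
  rmap_comp (rtmap (rmap_id (ext_mod y)) (Jmap a)) p = q.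

(* [L -> L \ox J(X) -> L \ox J(id1 X)] *)
Definition ext_id1 (x : ext_ob) : ext_hom (id1 (ext_base x)) :=
  rmap_comp (rtmap (rmap_id (ext_mod x)) (Junit (ext_base x)))
            (rrunitV (ext_mod x)).

Section ExtComp.
Variables (x y z : ext_ob).
Variables (g : hom1 (ext_base y) (ext_base z)).
Variables (f : hom1 (ext_base x) (ext_base y)).

(* [L_x -> L_y \ox J(f) -> (L_z \ox J(g)) \ox J(f)
    -> L_z \ox (J(g) \ox J(f))] *)
Definition ext_paste (q : ext_hom g) (p : ext_hom f) :
    rmap (ext_mod x) (rtens (ext_mod z) (btens (Jmod g) (Jmod f))) :=
  rmap_comp (rassoc (ext_mod z) (Jmod g) (Jmod f))
    (rmap_comp (rtmap q (bimap_id (Jmod f))) p).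

Definition ext_comp1 (q : ext_hom g) (p : ext_hom f) : ext_hom (g \o1 f) :=
  rmap_comp (rtmap (rmap_id (ext_mod z)) (Jmul g f)) (ext_paste q p).

Definition ext_mu (q : ext_hom g) (t : tens (ext_mod y) (Jmod f)) :
    tens (ext_mod z) (Jmod (g \o1 f)) :=
  rtmap (rmap_id (ext_mod z)) (Jmul g f)
    (rassoc (ext_mod z) (Jmod g) (Jmod f) (rtmap q (bimap_id (Jmod f)) t)).

Definition ext_ev (m : Jmod f) (t : tens (ext_mod z) (Jmod g)) :
    tens (ext_mod z) (Jmod (g \o1 f)) :=
  rtmap (rmap_id (ext_mod z)) (Jmul g f)
    (rassoc (ext_mod z) (Jmod g) (Jmod f) ((t : rtens _ _) \ox m)).

Lemma ext_comp1E q p l : ext_comp1 q p l = ext_mu q (p l).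
Proof. by rewrite !rmap_compE. Qed.

Lemma ext_muD q s t : ext_mu q (s + t) = ext_mu q s + ext_mu q t.
Proof. by rewrite /ext_mu !lfunD. Qed.

Lemma ext_muE q l m : ext_mu q (l \ox m) = ext_ev m (q l).
Proof. by rewrite /ext_mu rtmapE bimap_idE. Qed.

Lemma ext_evD m s t : ext_ev m (s + t) = ext_ev m s + ext_ev m t.
Proof. by rewrite /ext_ev pureDl !lfunD. Qed.

Lemma ext_evE m l n : ext_ev m (l \ox n) = l \ox Jmul g f (n \ox m).
Proof. by rewrite /ext_ev rassocE rtmapE rmap_idE. Qed.

End ExtComp.

Lemma ext_id1E (x : ext_ob) l :
  ext_id1 x l = l \ox Junit (ext_base x) (aone (Jalg (ext_base x))).
Proof. by rewrite rmap_compE rrunitVE rtmapE rmap_idE. Qed.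

Lemma ext_cellE (x y : ext_ob) (f g : hom1 (ext_base x) (ext_base y))
    (a : cell f g) (p : ext_hom f) (q : ext_hom g) :
  ext_cell a p q <->
  forall l, rtmap (rmap_id (ext_mod y)) (Jmap a) (p l) = q l.
Proof.
split=> [<- l | pq]; first by rewrite rmap_compE.
by apply: rmap_eq => l; rewrite rmap_compE.
Qed.

Lemma ext_actD (x y : ext_ob) (f g : hom1 (ext_base x) (ext_base y))
    (a : cell f g) s t :
  rtmap (rmap_id (ext_mod y)) (Jmap a) (s + t)
  = rtmap (rmap_id (ext_mod y)) (Jmap a) s
    + rtmap (rmap_id (ext_mod y)) (Jmap a) t.
Proof. exact: lfunD. Qed.

Lemma ext_actE (x y : ext_ob) (f g : hom1 (ext_base x) (ext_base y))
    (a : cell f g) l m :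
  rtmap (rmap_id (ext_mod y)) (Jmap a) (l \ox m) = l \ox Jmap a m.
Proof. by rewrite rtmapE rmap_idE. Qed.

(* The 2-cells from a composite are the 2-simplices [s] of [C] whose edges are
   decorated in such a way that [(id \ox J(s)) o (q \ox id) o p = r]. *)
Lemma ext_simplexP (x y z : ext_ob)
    (g : hom1 (ext_base y) (ext_base z)) (f : hom1 (ext_base x) (ext_base y))
    (h : hom1 (ext_base x) (ext_base z)) (s : cell (g \o1 f) h)
    (q : ext_hom g) (p : ext_hom f) (r : ext_hom h) :
  ext_cell s (ext_comp1 q p) r
  <-> rmap_comp (rtmap (rmap_id (ext_mod z)) (Jsimplex s)) (ext_paste q p) = r.
Proof.
rewrite /ext_cell; set u := rmap_comp _ (ext_comp1 _ _).
suff -> : rmap_comp (rtmap (rmap_id (ext_mod z)) (Jsimplex s))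
            (ext_paste q p) = u by [].
apply: rmap_eq => l; rewrite /u !rmap_compE.
elim/tens_ind: (rassoc _ _ _ _) => [k t | s1 s2 IH1 IH2].
  by rewrite !rtmapE !rmap_idE JsimplexE.
by rewrite !lfunD IH1 IH2.
Qed.

Lemma ext_did2 (x y : ext_ob) (f : hom1 (ext_base x) (ext_base y))
    (u : ext_hom f) : ext_cell (id2 f) u u.
Proof.
apply/ext_cellE => l; elim/tens_ind: (u l) => [k m | s t IHs IHt].
  by rewrite ext_actE Jmap_id.
by rewrite ext_actD IHs IHt.
Qed.

Lemma ext_act_vcomp (x y : ext_ob) (f g h : hom1 (ext_base x) (ext_base y))
    (b : cell g h) (a : cell f g) t :
  rtmap (rmap_id (ext_mod y)) (Jmap (b \ov a)) t =
  rtmap (rmap_id (ext_mod y)) (Jmap b) (rtmap (rmap_id (ext_mod y)) (Jmap a) t).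
Proof.
elim/tens_ind: t => [k m | s t IHs IHt].
  by rewrite !ext_actE Jmap_vcomp.
by rewrite !ext_actD IHs IHt.
Qed.

Lemma ext_dvcomp (x y : ext_ob) (f g h : hom1 (ext_base x) (ext_base y))
    (b : cell g h) (a : cell f g)
    (u : ext_hom f) (v : ext_hom g) (w : ext_hom h) :
  ext_cell b v w -> ext_cell a u v -> ext_cell (b \ov a) u w.
Proof.
move=> /ext_cellE bw /ext_cellE av; apply/ext_cellE => l.
by rewrite ext_act_vcomp av bw.
Qed.

Lemma ext_dhcomp (x y z : ext_ob) (g g' : hom1 (ext_base y) (ext_base z))
    (f f' : hom1 (ext_base x) (ext_base y)) (b : cell g g') (a : cell f f')
    (v : ext_hom g) (v' : ext_hom g') (u : ext_hom f) (u' : ext_hom f') :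
  ext_cell b v v' -> ext_cell a u u' ->
  ext_cell (b \oh a) (ext_comp1 v u) (ext_comp1 v' u').
Proof.
move=> /ext_cellE bv /ext_cellE au; apply/ext_cellE => l.
rewrite !ext_comp1E -au.
elim/tens_ind: (u l) => [k m | s t IHs IHt]; last first.
  by rewrite ext_muD !ext_actD ext_muD IHs IHt.
rewrite ext_actE !ext_muE -bv.
elim/tens_ind: (v k) => [k' n | s t IHs IHt]; last first.
  by rewrite ext_evD !ext_actD ext_evD IHs IHt.
by rewrite ext_actE !ext_evE ext_actE Jmul_nat.
Qed.

Lemma ext_dassoc (x y z w : ext_ob) (h : hom1 (ext_base z) (ext_base w))
    (g : hom1 (ext_base y) (ext_base z)) (f : hom1 (ext_base x) (ext_base y))
    (t : ext_hom h) (v : ext_hom g) (u : ext_hom f) :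
  ext_cell (assoc h g f) (ext_comp1 (ext_comp1 t v) u)
    (ext_comp1 t (ext_comp1 v u)).
Proof.
apply/ext_cellE => l; rewrite !ext_comp1E.
elim/tens_ind: (u l) => [k m | s1 s2 IH1 IH2]; last first.
  by rewrite !ext_muD ext_actD IH1 IH2.
rewrite !ext_muE ext_comp1E.
elim/tens_ind: (v k) => [k' n | s1 s2 IH1 IH2]; last first.
  by rewrite ext_muD !ext_evD ext_actD ext_muD IH1 IH2.
rewrite ext_evE !ext_muE.
elim/tens_ind: (t k') => [k'' p | s1 s2 IH1 IH2]; last first.
  by rewrite !ext_evD ext_actD IH1 IH2.
by rewrite !ext_evE ext_actE Jmul_assoc.
Qed.

Lemma ext_dlunit (x y : ext_ob) (f : hom1 (ext_base x) (ext_base y))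
    (u : ext_hom f) : ext_cell (lunit f) (ext_comp1 (ext_id1 y) u) u.
Proof.
apply/ext_cellE => l; rewrite ext_comp1E.
elim/tens_ind: (u l) => [k m | s t IHs IHt]; last first.
  by rewrite ext_muD ext_actD IHs IHt.
by rewrite ext_muE ext_id1E ext_evE ext_actE Jmul_lunit lact1.
Qed.

Lemma ext_drunit (x y : ext_ob) (f : hom1 (ext_base x) (ext_base y))
    (u : ext_hom f) : ext_cell (runit f) (ext_comp1 u (ext_id1 x)) u.
Proof.
apply/ext_cellE => l; rewrite ext_comp1E ext_id1E ext_muE.
elim/tens_ind: (u l) => [k m | s t IHs IHt]; last first.
  by rewrite ext_evD ext_actD IHs IHt.
by rewrite ext_evE ext_actE Jmul_runit ract1.
Qed.

Lemma ext_dinv (x y : ext_ob) (f g : hom1 (ext_base x) (ext_base y))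
    (a : cell f g) (b : cell g f) (u : ext_hom f) (v : ext_hom g) :
  b \ov a = id2 f -> ext_cell a u v -> ext_cell b v u.
Proof.
move=> ba /ext_cellE av; apply/ext_cellE => l.
by rewrite -av -ext_act_vcomp ba; apply/ext_cellE: l; apply: ext_did2.
Qed.

Definition ext_decoration : decoration C :=
  @Decoration C ext_ob ext_base ext_hom ext_cell ext_id1 ext_comp1
    ext_did2 ext_dvcomp ext_dhcomp ext_dassoc ext_dlunit ext_drunit ext_dinv.

Definition ext_bicat : bicategory := decorated ext_decoration.

Definition ext_proj : pseudofunctor ext_bicat C :=
  decorated_proj ext_decoration.

Definition regular_ob (X : C) : ext_bicat := ExtOb (regular_rmod (Jalg X)).

Definition is_regular_ob (x : ext_bicat) : Prop :=
  exists X : C, x = regular_ob X.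

Definition reg_bicat : bicategory := full_sub is_regular_ob.

Definition reg_incl : pseudofunctor reg_bicat ext_bicat :=
  full_incl is_regular_ob.

Definition reg_proj : pseudofunctor reg_bicat C := pf_comp ext_proj reg_incl.

Section Canonical.
Variables (X Y : C) (f : hom1 X Y) (v : Jmod f).

Definition canon_fun (a : Jalg X) : tens (regular_rmod (Jalg Y)) (Jmod f) :=
  (aone (Jalg Y) : regular_rmod (Jalg Y)) \ox (v \ra a).

Lemma canon_linear : linear canon_fun.
Proof. by move=> k a b; rewrite /canon_fun ract_linr pure_linr. Qed.

Definition canon_lfun :
    'Hom(Jalg X, tens (regular_rmod (Jalg Y)) (Jmod f)) := linfun canon_fun.

Lemma canon_lfunE a : canon_lfun a = canon_fun a.
Proof.
pose g : {linear Jalg X -> tens (regular_rmod (Jalg Y)) (Jmod f)} :=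
  HB.pack canon_fun (GRing.isLinear.Build _ _ _ _ _ canon_linear).
exact: (lfunE g).
Qed.

Lemma canon_ract (m : regular_rmod (Jalg X)) (a : Jalg X) :
  canon_lfun (m \ra a)
  = (canon_lfun m : rtens (regular_rmod (Jalg Y)) (Jmod f)) \ra a.
Proof. by rewrite !canon_lfunE /canon_fun pure_ract -ractM. Qed.

Definition canon_rmap :
    rmap (regular_rmod (Jalg X)) (rtens (regular_rmod (Jalg Y)) (Jmod f)) :=
  @RMap K (Jalg X) (regular_rmod (Jalg X))
    (rtens (regular_rmod (Jalg Y)) (Jmod f)) canon_lfun canon_ract.

End Canonical.

Definition regular_hom (X Y : st_bicat) (f : hom1 X Y) :
    hom1 (regular_ob X) (regular_ob Y) :=
  existT _ (projT1 f) (canon_rmap (projT2 f)).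

End Extensions.

(* Main.v *)
(** A map of right modules [J(X) -> J(Y) \ox J(f)] is determined by the image
    of [1], and [J(Y) \ox J(f)] is [J(f)], so the decorations of [f] between
    regular objects are the elements of [J(f)]; under this correspondence the
    conditions on 2-simplices agree.  The resulting functor is the identity on
    underlying data in [C], so all its comparison cells are identities. *)

Require Import Defs.
From mathcomp Require Import all_boot all_order all_algebra.
From mathcomp Require Import boolp.

Set Implicit Arguments.
Unset Strict Implicit.
Unset Printing Implicit Defensive.

(** Both sides share [o], [m] and [c], so their comparison cells have the same types and can be
    compared without transport; the laws are propositions. *)
Lemma lax_functor_eq (B C : bicategory) (o : B -> C)
    (m : forall x y, hom1 x y -> hom1 (o x) (o y))
    (c : forall x y (f g : hom1 x y), cell f g -> cell (m x y f) (m x y g))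
    (i i' : forall x, cell (id1 (o x)) (m x x (id1 x)))
    (t t' : forall x y z (g : hom1 y z) (f : hom1 x y),
      cell (m y z g \o1 m x y f) (m x z (g \o1 f)))
    p1 p2 p3 p4 p5 p6 q1 q2 q3 q4 q5 q6 :
  (forall x, i x = i' x) ->
  (forall x y z (g : hom1 y z) (f : hom1 x y), t x y z g f = t' x y z g f) ->
  @LaxFunctor B C o m c i t p1 p2 p3 p4 p5 p6
  = @LaxFunctor B C o m c i' t' q1 q2 q3 q4 q5 q6.
Proof.
move=> ii' tt'; have ei : i = i' by apply: functional_extensionality_dep.
have et : t = t'.
  by do 5![apply: functional_extensionality_dep => ?]; apply: tt'.
by subst i' t'; congr LaxFunctor; apply: Prop_irrelevance.
Qed.

Lemma pseudofunctor_eq (B C : bicategory) (F G : pseudofunctor B C) :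
  pf_lax F = pf_lax G -> F = G.
Proof.
case: F G => [F Fi Fc] [G Gi Gc] /= FG; subst G.
by congr Pseudofunctor; apply: Prop_irrelevance.
Qed.

Lemma equivalent_obs_refl (B : bicategory) (x : B) : equivalent_obs x x.
Proof.
have xx : iso1 (id1 x \o1 id1 x) (id1 x).
  exists (lunit (id1 x)), (lunitV (id1 x)).
  by split; [apply: lunitK | apply: lunitVK].
by exists (id1 x), (id1 x).
Qed.

Section DecoratedIso.
Variables (C : bicategory) (D : decoration C) (x y : dob D).

(** By [dinv], an inverse of the underlying 2-cell is automatically compatible with the
    decorations. *)
Lemma decorated_invertible2 (f g : @hom1 (decorated D) x y) (a : cell f g) :
  invertible2 (sval a) -> invertible2 a.
Proof.
case: a => [a Da] /= [b [ba ab]].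
by exists (exist _ b (dinv ba Da)); split; apply: decorated_cell_eq.
Qed.

Lemma decorated_iso1 (f : hom1 (dbase x) (dbase y)) (u v : dhom f) :
  dcell (id2 f) u v ->
  @iso1 (decorated D) x y (existT _ f u) (existT _ f v).
Proof.
move=> uv.
pose a : decorated_cell (existT _ f u) (existT _ f v) := exist _ (id2 f) uv.
by exists a; apply/decorated_invertible2/id2_invertible.
Qed.

End DecoratedIso.

Section Regular.
Variables (K : fieldType) (C : bicategory) (J : lax_functor C (morita K)).
Implicit Types X Y Z : C.

Lemma canon_rmapE X Y (f : hom1 X Y) (v : Jmod J f) a :
  canon_rmap v a = (aone (Jalg J Y) : regular (Jalg J Y)) \ox (v \ra a).
Proof. exact: canon_lfunE. Qed.

Lemma tlunitVK (A B : fdalgebra K) (M : bimodule B A) t :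
  tlunitV M (tlunit M t) = t.
Proof.
elim/tens_ind: t => [b m | s t IHs IHt]; last by rewrite !lfunD IHs IHt.
by rewrite tlunitE tlunitVE -pure_bal /= amul1l.
Qed.

(** A right-linear map out of the regular module is fixed by its value at 1, and [tlunit] turns this
    value into an element of [Jmod J f]. *)
Lemma canon_surj X Y (f : hom1 X Y)
    (p : rmap (regular_rmod (Jalg J X))
              (rtens (regular_rmod (Jalg J Y)) (Jmod J f))) :
  canon_rmap (tlunit (Jmod J f) (p (aone (Jalg J X)))) = p.
Proof.
apply: rmap_eq => l; rewrite canon_rmapE -tlunitVE.
rewrite tlunitV_ract tlunitVK -rfunP /=.
by rewrite amul1l.
Qed.

(** Right-linearity of [Jmap a] reduces compatibility to its instance at 1. *)
Lemma canon_cellP X Y (f g : hom1 X Y) (a : cell f g)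
    (u : Jmod J f) (v : Jmod J g) :
  @ext_cell _ _ J (regular_ob J X) (regular_ob J Y) f g a
    (canon_rmap u) (canon_rmap v) <-> st_cell a u v.
Proof.
split=> [/ext_cellE/(_ (aone (Jalg J X))) | uv].
  rewrite !canon_rmapE !ract1 ext_actE.
  (* Multiplying out the tensors cancels the left factors 1. *)
  by move/(congr1 (tlunit (Jmod J g))); rewrite !tlunitE !lact1.
by apply/ext_cellE => l; rewrite !canon_rmapE ext_actE rfunP uv.
Qed.

(** As [Junit] is a bimodule map, [l] acts on its value at 1 equally from the right and from the
    left, and the left action crosses the tensor sign. *)
Lemma ext_id1_canon X : ext_id1 (regular_ob J X) = canon_rmap (st_id1 J X).
Proof.
apply: rmap_eq => l; rewrite ext_id1E canon_rmapE /st_id1.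
rewrite -rfunP /= amul1l -[in RHS](amul1r l).
by rewrite (bfunP (Junit J X) l (aone _)) -pure_bal /= amul1l.
Qed.

(** Both sides send [l] to [aone _ \ox Jmul J g f (v \ox (u \ra l))], since [Jmul] is
    right-linear. *)
Lemma ext_comp1_canon X Y Z (g : hom1 Y Z) (f : hom1 X Y)
    (v : Jmod J g) (u : Jmod J f) :
  @ext_comp1 _ _ J (regular_ob J X) (regular_ob J Y) (regular_ob J Z) g f
    (canon_rmap v) (canon_rmap u) = canon_rmap (st_comp1 v u).
Proof.
apply: rmap_eq => l; rewrite ext_comp1E !canon_rmapE ext_muE canon_rmapE.
by rewrite ract1 ext_evE /st_comp1 -rfunP pure_ract.
Qed.

Definition reg_ob X : reg_bicat J :=
  exist _ (regular_ob J X) (ex_intro _ X erefl).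

(** Equal decorations thus give comparison cells over identities of [C], with no transport between
    1-morphisms. *)
Lemma ext_cell_id2 (x y : ext_ob J) (f : hom1 (ext_base x) (ext_base y))
    (p q : ext_hom f) : p = q -> ext_cell (id2 f) p q.
Proof. by move=> ->; apply: ext_did2. Qed.

Definition st_to_reg_lax : lax_functor (st_bicat J) (reg_bicat J).
Proof.
apply: (@LaxFunctor (st_bicat J) (reg_bicat J) reg_ob
  (fun X Y f => regular_hom f)
  (fun X Y f g a => exist _ (sval a) (proj2 (canon_cellP _ _ _) (svalP a)))
  (fun X => exist _ (id2 (id1 X)) (ext_cell_id2 (ext_id1_canon X)))
  (fun X Y Z g f => exist _ (id2 (projT1 g \o1 projT1 f))
     (ext_cell_id2 (ext_comp1_canon (projT2 g) (projT2 f))))).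
- abstract by intros; apply: decorated_cell_eq.
- abstract by intros; apply: decorated_cell_eq.
- abstract by intros; apply: decorated_cell_eq; rewrite /= vcomp1l vcomp1r.
- abstract by intros; apply: decorated_cell_eq;
    rewrite /= !hcomp_id !vcomp1l vcomp1r.
- abstract by intros; apply: decorated_cell_eq; rewrite /= !hcomp_id !vcomp1r.
- abstract by intros; apply: decorated_cell_eq; rewrite /= !hcomp_id !vcomp1r.
Defined.

Lemma st_to_reg_id_inv (X : st_bicat J) : invertible2 (lax_id st_to_reg_lax X).
Proof.
exact/(@decorated_invertible2 _ (ext_decoration J))/id2_invertible.
Qed.

Lemma st_to_reg_comp_inv (X Y Z : st_bicat J) (g : hom1 Y Z) (f : hom1 X Y) :
  invertible2 (lax_comp st_to_reg_lax g f).
Proof.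
exact/(@decorated_invertible2 _ (ext_decoration J))/id2_invertible.
Qed.

Definition st_to_reg : pseudofunctor (st_bicat J) (reg_bicat J) :=
  @Pseudofunctor (st_bicat J) (reg_bicat J) st_to_reg_lax
    st_to_reg_id_inv st_to_reg_comp_inv.

Lemma st_to_reg_biequivalence : biequivalence st_to_reg.
Proof.
split.
- by move=> [x [X xX]]; exists X; subst x; apply: equivalent_obs_refl.
- move=> X Y [f p].
  exists (existT _ f (tlunit (Jmod J f) (p (aone (Jalg J X))))).
  apply: (@decorated_iso1 _ (ext_decoration J)).
  exact/ext_cell_id2/canon_surj.
- move=> X Y f g.
  (* The inverse keeps the underlying 2-cell of [C] and reads [canon_cellP] in the other
     direction. *)
  pose inv (a : cell (F1 st_to_reg f) (F1 st_to_reg g)) :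
      @decorated_cell _ (st_decoration J) X Y f g :=
    exist _ (sval a) (proj1 (canon_cellP _ _ _) (svalP a)).
  by exists inv => a; apply: decorated_cell_eq.
Qed.

(** The equality is strict: objects, 1-morphisms and 2-cells agree by computation, and the
    comparison cells on the left are composites of identities. *)
Lemma reg_proj_st_to_reg : pf_comp (reg_proj J) st_to_reg = st_proj J.
Proof.
apply/pseudofunctor_eq/lax_functor_eq => *.
  by rewrite /= /lfc_id /= /lfc_id /= !vcomp1l.
by rewrite /= /lfc_comp /= /lfc_comp /= !vcomp1l.
Qed.

End Regular.

Theorem proposition7p4 (K : fieldType) (C : bicategory)
    (J : normal_lax_functor C (morita K)) :
  exists F : pseudofunctor (st_bicat J) (reg_bicat J),
    [/\ biequivalence F,
        pf_comp (reg_proj J) F = st_proj J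
      & forall (X Y : st_bicat J) (f : hom1 X Y),
          arrow (F1 (pf_comp (reg_incl J) F) f) = arrow (regular_hom f)].
Proof.
(* The condition on arrows holds by computation. *)
exists (st_to_reg J); split=> //; last exact: reg_proj_st_to_reg.
exact: st_to_reg_biequivalence.
Qed.
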